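(* Assume that $n \geq 4$ and $|A| = 2$. If $f \colon A^n \to B$ is weakly determined by the order of first occurrence, then $f$ is reconstructible.
   Context: $B$ is a set with at least two elements; $n$ is a positive integer. $[n] := \{1,\dots,n\}$, $\binom{[n]}{2}$ denotes the set of all $2$-element subsets of $[n]$, and $\Sigma_n$ is the symmetric group on $[n]$. For $\mathbf{a} \in A^n$ and $\sigma \colon [m] \to [n]$, write $\mathbf{a}\sigma := (a_{\sigma(1)},\dots,a_{\sigma(m)}) \in A^m$. Functions $f, g \colon A^n \to B$ are equivalent, $f \equiv g$, if there is $\sigma \in \Sigma_n$ with $f(\mathbf{a}) = g(\mathbf{a}\sigma)$ for all $\mathbf{a} \in A^n$. For $n \geq 2$, $f \colon A^n \to B$ and $I \in \binom{[n]}{2}$, the identification minor $f_I \colon A^{n-1} \to B$ is given by $f_I(\mathbf{a}) = f(\mathbf{a}\delta_I)$, where $\delta_I \colon [n] \to [n-1]$ is defined by $\delta_I(i) = i$ if $i < \max I$, $\delta_I(i) = \min I$ if $i = \max I$, and $\delta_I(i) = i-1$ if $i > \max I$. The deck of $f$, $\operatorname{deck} f$, is the multiset $\{f_I/{\equiv} : I \in \binom{[n]}{2}\}$ of equivalence classes. A function $g \colon A^n \to B$ is a reconstruction of $f$ if $\operatorname{deck} f = \operatorname{deck} g$. The function $f$ is reconstructible if it is equivalent to all of its reconstructions. Let $A^r_{\neq}$ be the set of $r$-tuples over $A$ with pairwise distinct entries and $A^\sharp := \bigcup_{r \geq 1} A^r_{\neq}$. The map $\operatorname{ofo} \colon \bigcup_{n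 \geq 1} A^n \to A^\sharp$ sends a tuple $\mathbf{a}$ to the tuple listing the distinct elements occurring in $\mathbf{a}$ in the order of their first occurrence. A function $f \colon A^n \to B$ is weakly determined by the order of first occurrence if there exist $f^* \colon A^\sharp \to B$ and $\sigma \in \Sigma_n$ such that $f(\mathbf{a}) = f^*(\operatorname{ofo}(\mathbf{a}\sigma))$ for all $\mathbf{a} \in A^n$. *)

(* Defs.v *)
From mathcomp Require Import all_boot all_fingroup.
From mathcomp Require Import boolp classical_sets.

Set Implicit Arguments.
Unset Strict Implicit.
Unset Printing Implicit Defensive.

Local Open Scope nat_scope.

(* A^n is n.-tuple A, and [n] is 'I_n, i.e. indices start at 0. *)

Definition tup_comp (A : Type) (m n : nat) (a : n.-tuple A) (s : 'I_m -> 'I_n) :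
  m.-tuple A := [tuple tnth a (s i) | i < m].

Definition fun_equiv (A B : Type) (n : nat) (f g : n.-tuple A -> B) : Prop :=
  exists s : 'S_n, forall a : n.-tuple A, f a = g (tup_comp a s).

Definition fun_class (A B : Type) (n : nat) (f : n.-tuple A -> B) :
  set (n.-tuple A -> B) := [set g | fun_equiv f g]%classic.

Definition pairs (n : nat) : Type := {I : {set 'I_n} | #|I| == 2}.

Definition pair_min (n : nat) (I : pairs n) : nat :=
  \big[minn/n]_(i in val I) (i : nat).

Definition pair_max (n : nat) (I : pairs n) : nat :=
  \max_(i in val I) (i : nat).

Definition delta_nat (n : nat) (I : pairs n) (i : nat) : nat :=
  if i < pair_max I then i
  else if i == pair_max I then pair_min I
  else i.-1.

Lemma delta_subproof (n : nat) (I : pairs n.+1) (i : 'I_n.+1) :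
  delta_nat I i < n.
Proof.
case: I => I cI; rewrite /delta_nat /pair_max /pair_min /=.
have /cards2P[x [y [xy eI]]] := cI.
have minle (z : 'I_n.+1) : z \in I -> \big[minn/n.+1]_(j in I) (j : nat) <= z.
  elim: (index_enum _) (mem_index_enum z) => // j r IHr zr zI.
  rewrite big_cons; move: zr; rewrite inE => /predU1P[<-|zr].
    by rewrite zI geq_minl.
  by case: ifP => _; rewrite ?geq_min IHr ?orbT.
have maxge (z : 'I_n.+1) : z \in I -> z <= \max_(j in I) (j : nat).
  by move=> zI; exact: (leq_bigmax_cond z).
have maxn : \max_(j in I) (j : nat) <= n.
  by apply/bigmax_leqP => j _; rewrite -ltnS.
have xI : x \in I by rewrite eI !inE eqxx.
have yI : y \in I by rewrite eI !inE eqxx orbT.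
have minmax : \big[minn/n.+1]_(j in I) (j : nat) < \max_(j in I) (j : nat).
  have : (x : nat) != y by [].
  rewrite neq_ltn => /orP[] lt.
    exact: leq_trans (leq_ltn_trans (minle _ xI) lt) (maxge _ yI).
  exact: leq_trans (leq_ltn_trans (minle _ yI) lt) (maxge _ xI).
case: (ltngtP i (\max_(j in I) j)) => [lt|gt|_]; first exact: leq_trans lt maxn.
  by case: (i : nat) gt (ltn_ord i) => // k _; rewrite ltnS.
exact: leq_trans minmax maxn.
Qed.

Definition delta (n : nat) (I : pairs n.+1) (i : 'I_n.+1) : 'I_n :=
  Ordinal (delta_subproof I i).

Definition id_minor (A B : Type) (n : nat) (f : n.+1.-tuple A -> B)
    (I : pairs n.+1) : n.-tuple A -> B :=
  fun a => f (tup_comp a (delta I)).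

(* A multiset of equivalence classes, given by its multiplicity function. *)
Definition deck (A B : Type) (n : nat) (f : n.+1.-tuple A -> B) :
  set (n.-tuple A -> B) -> nat :=
  fun C => #|[pred I : pairs n.+1 | `[< fun_class (id_minor f I) = C >]]|.

Definition reconstruction (A B : Type) (n : nat) (g f : n.+1.-tuple A -> B) :
  Prop := deck f = deck g.

Definition reconstructible (A B : Type) (n : nat) (f : n.+1.-tuple A -> B) :
  Prop :=
  forall g : n.+1.-tuple A -> B, reconstruction g f -> fun_equiv f g.

Definition sharp (A : eqType) : Type :=
  {s : seq A | uniq s && (s != [::])}.

(* [undup] would list the elements by their last occurrence instead. *)
Fixpoint ofo_seq (A : eqType) (s : seq A) : seq A :=
  if s is x :: s' then x :: [seq y <- ofo_seq s' | y != x] else [::].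

Lemma ofo_subproof (A : eqType) (n : nat) (a : n.+1.-tuple A) :
  uniq (ofo_seq a) && (ofo_seq a != [::]).
Proof.
apply/andP; split; last by case/tupleP: a.
elim: (val a) => //= x s IHs.
by rewrite mem_filter eqxx /= filter_uniq.
Qed.

Definition ofo (A : eqType) (n : nat) (a : n.+1.-tuple A) : sharp A :=
  exist _ (ofo_seq a) (ofo_subproof a).

Definition weakly_determined_ofo (A : eqType) (B : Type) (n : nat)
    (f : n.+1.-tuple A -> B) : Prop :=
  exists (fstar : sharp A -> B) (s : 'S_n.+1),
    forall a : n.+1.-tuple A, f a = fstar (ofo (tup_comp a s)).

(* Main.v *)
Require Import Defs.
From mathcomp Require Import all_boot all_fingroup.
From mathcomp Require Import boolp classical_sets.

(** For a two-element [A], [f] is weakly determined by the order of first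
    occurrence iff its value on a constant tuple is arbitrary and its value on
    any other tuple depends only on the [k]-th entry, for a fixed [k].  All
    identification minors of such an [f] are equivalent to each other and have
    the same form.  If [g] has the same deck, then for each pair [{x, y}] there
    is an index [t] such that [g], on the tuples with equal entries at [x] and
    [y], reads its [t]-th entry.  Comparing overlapping pairs shows (from four
    variables on) that one [t] serves all pairs, and as every tuple has a
    repeated entry this determines [g] up to equivalence. *)

Set Implicit Arguments.
Unset Strict Implicit.
Unset Printing Implicit Defensive.

(** * Order of first occurrence over a two-element alphabet *)

Definition const_or_entry (A : eqType) (B : Type) (con u : A -> B) (n : nat)
    (k : 'I_n) (a : n.-tuple A) : B :=
  if [forall i, tnth a i == tnth a k] then con (tnth a k) else u (tnth a k).

Lemma mem_ofo_seq (A : eqType) (s : seq A) : ofo_seq s =i s.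
Proof.
elim: s => //= x s IHs z.
by rewrite !inE mem_filter IHs; case: eqVneq.
Qed.

Lemma ofo_seq_uniq (A : eqType) (s : seq A) : uniq (ofo_seq s).
Proof. by elim: s => //= x s IHs; rewrite mem_filter eqxx /= filter_uniq. Qed.

(** Once [x] is filtered out, the tail is duplicate-free and can only contain [y], so it is empty or
    [[:: y]]. *)
Lemma ofo_seq_cons2 (A : eqType) (x y : A) (s : seq A) :
    x != y -> (forall z, z \in s -> z = x \/ z = y) ->
  ofo_seq (x :: s) = if all (pred1 x) s then [:: x] else [:: x; y].
Proof.
move=> xy s_xy /=; case: ifPn => [/allP s_x|/allPn[/= z zs zx]].
  congr (_ :: _); rewrite (eq_in_filter (a2 := pred0)) ?filter_pred0 // => z.
  by rewrite mem_ofo_seq => /s_x /= ->.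
congr (_ :: _); apply: perm_small_eq => //; apply: uniq_perm => //.
  by rewrite filter_uniq ?ofo_seq_uniq.
move=> w; rewrite mem_filter mem_ofo_seq !inE.
have [-> | wx] := eqVneq w x; first by rewrite (negPf xy).
apply/idP/eqP => [/s_xy[/eqP|//] | ->]; first by rewrite (negPf wx).
by case: (s_xy z zs) => [/eqP|<-//]; rewrite (negPf zx).
Qed.

(** Surjectivity of [s] ensures that [a] and its reindexing have the same set of entries, so that
    one is constant iff the other is. *)
Lemma const_or_entry_comp (A : eqType) (B : Type) (con u : A -> B)
    (m n : nat) (s : 'I_m -> 'I_n) (k : 'I_m) (a : n.-tuple A) :
    (forall j, exists i, s i = j) ->
  const_or_entry con u k (tup_comp a s) = const_or_entry con u (s k) a.
Proof.
move=> s_surj; rewrite /const_or_entry /tup_comp !tnth_mktuple.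
congr (if _ then _ else _); apply/forallP/forallP => h i.
  by have [j <-] := s_surj i; move: (h j); rewrite !tnth_mktuple.
by rewrite !tnth_mktuple.
Qed.

Lemma const_or_entry_perm (A : eqType) (B : Type) (con u : A -> B)
    (n : nat) (s : 'S_n) (k : 'I_n) (a : n.-tuple A) :
  const_or_entry con u k (tup_comp a s) = const_or_entry con u (s k) a.
Proof.
by apply: const_or_entry_comp => j; exists (s^-1%g j); rewrite permKV.
Qed.

Lemma fun_equiv_const_or_entry (A : eqType) (B : Type) (con u : A -> B)
    (n : nat) (k l : 'I_n) (f g : n.-tuple A -> B) :
    f =1 const_or_entry con u k -> g =1 const_or_entry con u l ->
  fun_equiv f g.
Proof.
move=> fE gE; exists (tperm l k) => a.
by rewrite fE gE const_or_entry_perm tpermL.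
Qed.

Lemma weakly_determined_const_or_entry (A : finType) (B : Type) (n : nat)
    (f : n.+1.-tuple A -> B) :
    #|A| = 2 -> weakly_determined_ofo f ->
  exists con u k, f =1 const_or_entry con u k.
Proof.
move=> cA [fstar [s fE]].
have /eqP/cards2P[x0 [x1 [x01 AE]]] : #|[set: A]%SET| = 2 by rewrite cardsT.
have xP z : z = x0 \/ z = x1.
  have : z \in [set: A]%SET by rewrite inE.
  by rewrite AE !inE => /orP[]/eqP; [left | right].
pose o x := if x == x0 then x1 else x0.
have oP x : x != o x.
  by rewrite /o; case: (eqVneq x x0) => [->|].
have oU x : uniq [:: x; o x] && ([:: x; o x] != [::]) by rewrite /= inE oP.
pose c x : sharp A := exist _ [:: x] isT.
pose d x : sharp A := exist _ [:: x; o x] (oU x).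
(* The first letter of the permuted tuple is the entry of [a] at [s ord0]. It determines the whole
   sequence up to whether the other letter [o x] occurs. *)
exists (fun x => fstar (c x)), (fun x => fstar (d x)), (s ord0) => a.
rewrite fE -const_or_entry_perm /const_or_entry; set b := tup_comp a s.
have bE : ofo_seq b = if [forall i, tnth b i == tnth b ord0]
    then [:: tnth b ord0] else [:: tnth b ord0; o (tnth b ord0)].
  have bT : val b = tnth b ord0 :: behead b.
    by rewrite (tnth_nth (tnth b ord0)); case: (tupleP b).
  rewrite {1}bT (@ofo_seq_cons2 _ _ (o (tnth b ord0))) //; last first.
    move=> z _; rewrite /o; case: (xP z) (xP (tnth b ord0)) => -> [] ->;
    by rewrite ?eqxx ?(eq_sym x1) ?(negPf x01); auto.
  congr (if _ then _ else _).
  have -> : all (pred1 (tnth b ord0)) (behead b) = all (pred1 (tnth b ord0)) b.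
    by rewrite [in RHS]bT /= eqxx.
  apply/allP/forallP => [h i|h z /tnthP[i ->]]; last exact: h.
  by apply: h; apply: mem_tnth.
by case: ifP bE => _ bE; congr (fstar _); apply: eq_exist.
Qed.

(** * Identification minors in terms of index pairs *)

Section PairIndex.

Variables (n : nat) (x y : 'I_n.+1).
Hypothesis xy : x < y.

Lemma card_set2_lt : #|[set x; y]| == 2.
Proof. by rewrite cards2 -val_eqE neq_ltn xy. Qed.

Definition pair_of : pairs n.+1 := exist _ [set x; y] card_set2_lt.

Lemma pair_min_of : pair_min pair_of = x.
Proof.
rewrite /pair_min /=; apply/eqP; rewrite eqn_leq; apply/andP; split.
  have: x \in [set x; y] by rewrite !inE eqxx.
  elim: (index_enum _) (mem_index_enum x) => // j r IHr xr xI.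
  rewrite big_cons; move: xr; rewrite inE => /predU1P[<-|xr].
    by rewrite xI geq_minl.
  by case: ifP => _; rewrite ?geq_min IHr ?orbT.
apply: (big_ind (fun m => x <= m)) => [|i j xi xj|i]; first exact: ltnW.
  by rewrite leq_min xi.
by rewrite !inE => /orP[]/eqP-> //; exact: ltnW.
Qed.

Lemma pair_max_of : pair_max pair_of = y.
Proof.
rewrite /pair_max /=; apply/eqP; rewrite eqn_leq; apply/andP; split.
  by apply/bigmax_leqP => j; rewrite !inE => /orP[]/eqP-> //; exact: ltnW.
by apply: (leq_bigmax_cond y); rewrite !inE eqxx orbT.
Qed.

(** Since [lift y] is injective, this characterises [delta] as the collapse of [y] onto [x], without
    the case analysis on [max I]. *)
Lemma lift_delta i : lift y (delta pair_of i) = if i == y then x else i.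
Proof.
apply: val_inj; rewrite /= /delta_nat pair_min_of pair_max_of /bump -val_eqE /=.
have [-> | iy] := eqVneq (val i) (val y); first by rewrite ltnn leqNgt xy.
case: (ltngtP i y) iy => //= [iy|yi] _; first by rewrite leqNgt iy.
by case: (val i) yi => // j; rewrite ltnS /= => ->.
Qed.

End PairIndex.

Lemma delta_surj (n : nat) (I : pairs n.+1) (j : 'I_n) :
  exists i, delta I i = j.
Proof.
have /cards2P[x [y [xy eI]]] := valP I.
wlog lt_xy : x y xy eI / x < y.
  move=> H; move: (xy); rewrite -val_eqE neq_ltn => /orP[|lt]; first exact: H.
  by apply: (H y x) => //; rewrite 1?eq_sym // finset.setUC.
have -> : I = pair_of lt_xy by apply: val_inj.
exists (lift y j); apply: (@lift_inj _ y).
by rewrite lift_delta eq_sym (negPf (neq_lift _ _)).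
Qed.

Lemma tup_comp_delta (A : Type) (n : nat) (x y : 'I_n.+1) (xy : x < y)
    (b : n.+1.-tuple A) :
    tnth b x = tnth b y ->
  b = tup_comp (tup_comp b (lift y)) (delta (pair_of xy)).
Proof.
move=> bxy; apply: eq_from_tnth => i.
by rewrite !tnth_mktuple lift_delta; case: eqP => // ->.
Qed.

(** Tuples with equal entries at [x] and [y] are those that the minor at [{x, y}] feeds to [g]; any
    preimage under [delta] of the index read by the minor serves as [t]. *)
Lemma eq_entry_id_minor (A : eqType) (B : Type) (con u : A -> B) (n : nat)
    (g : n.+1.-tuple A -> B) (x y : 'I_n.+1) :
    (forall I, exists t, id_minor g I =1 const_or_entry con u t) -> x != y ->
  exists t, forall b, tnth b x = tnth b y -> g b = const_or_entry con u t b.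
Proof.
move=> gE; wlog xy : x y / x < y => [H|_].
  move=> xy; move: (xy); rewrite -val_eqE neq_ltn => /orP[lt|lt]; first exact: H.
  have [|t tP] := H _ _ lt; first by rewrite eq_sym.
  by exists t => b bxy; apply: tP.
have [t tE] := gE (pair_of xy); have [t' t'E] := delta_surj (pair_of xy) t.
exists t' => b bxy; rewrite (tup_comp_delta xy bxy).
rewrite const_or_entry_comp ?t'E -?tE //; exact: delta_surj.
Qed.

(** * One index read for all pairs *)

Section CommonEntry.

Variables (A : finType) (B : Type) (con u : A -> B) (n : nat).
Variable g : n.-tuple A -> B.

Let reads x y t :=
  forall b, tnth b x = tnth b y -> g b = const_or_entry con u t b.

Hypotheses (n_ge4 : 4 <= n) (card_A : #|A| = 2).
Hypothesis g_reads : forall x y, x != y -> exists t, reads x y t.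

(** On a constant tuple all entries agree anyway; on any other, both sides are values of the
    injective [u]. *)
Lemma reads_agree x y t x' y' t' (b : n.-tuple A) :
    injective u -> reads x y t -> reads x' y' t' ->
    tnth b x = tnth b y -> tnth b x' = tnth b y' ->
  tnth b t = tnth b t'.
Proof.
move=> u_inj rt rt' bxy bxy'; have := rt b bxy; rewrite (rt' b bxy').
rewrite /const_or_entry.
case: forallP => [h _|_]; first exact/eqP/h.
by case: forallP => [h _|_ /u_inj //]; apply/esym/eqP/h.
Qed.

(** Evaluate on the two-valued indicator tuple of [X]. Choosing an [X] that splits neither pair then
    constrains [t] and [t']; this is the tool for all comparisons below. *)
Lemma reads_separate x y t x' y' t' (X : {set 'I_n}) :
    injective u -> reads x y t -> reads x' y' t' ->
    (x \in X) = (y \in X) -> (x' \in X) = (y' \in X) ->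
  (t \in X) = (t' \in X).
Proof.
move=> u_inj rt rt' Xxy Xxy'.
have /eqP/cards2P[x0 [x1 [x01 _]]] : #|[set: A]%SET| = 2 by rewrite cardsT.
pose b := [tuple if i \in X then x1 else x0 | i < n].
have bE i : tnth b i = if i \in X then x1 else x0 by rewrite tnth_mktuple.
have := @reads_agree _ _ _ _ _ _ b u_inj rt rt'; rewrite !bE Xxy Xxy'.
move=> /(_ erefl erefl); case: (t \in X); case: (t' \in X) => // /eqP.
  by rewrite eq_sym (negPf x01).
by rewrite (negPf x01).
Qed.

Lemma ord_fresh (s : seq 'I_n) : size s < n -> exists i, i \notin s.
Proof.
move=> ltn; apply/existsP; apply: contraLR ltn; rewrite negb_exists -leqNgt.
move=> /forallP h; rewrite -[leqLHS]card_ord (leq_trans _ (card_size s)) //.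
by apply/subset_leq_card/fintype.subsetP => i _; rewrite -[_ \in _]negbK h.
Qed.

Lemma reads_outside (i j : 'I_n) :
    injective u -> i != j ->
  exists x y t, [/\ x != y, t != x, t != y & reads x y t].
Proof.
move=> u_inj ij.
have [v] := @ord_fresh [:: i; j] (ltnW n_ge4).
have [w] := @ord_fresh [:: i; j; v] n_ge4.
rewrite !inE !negb_or => /and3P[wi wj wv] /andP[vi vj].
have [t tP] := g_reads ij; have [t' t'P] := g_reads wv.
have [ti|ti] := boolP (t \in [set i; j]); last first.
  by exists i, j, t; move: ti; rewrite !inE negb_or => /andP[].
(* If [t] lies in [{i, j}], this set splits neither pair, so [t'] lies in it too and thus avoids the
   disjoint pair [{w, v}]. *)
exists w, v, t'; split=> //; apply/eqP => t'E;
have := @reads_separate _ _ _ _ _ _ [set i; j] u_inj tP t'P;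
by rewrite ti t'E !inE !eqxx ?orbT ?(negPf wi) ?(negPf wj) ?(negPf vi)
  ?(negPf vj) => /(_ erefl erefl).
Qed.

(** When the entries at [x] and [y] coincide, reading either end gives the same value. *)
Lemma reads_ends x y t k :
    t = k \/ x = k /\ t = y -> reads x y t -> reads x y k.
Proof.
case=> [<- //|[xk ty]] rt b bxy; rewrite (rt b bxy) /const_or_entry.
by rewrite ty -xk bxy.
Qed.

Lemma reads_fresh (i j k y : 'I_n) :
    injective u -> k != i -> k != j -> reads i j k ->
    y != k -> y != i -> y != j ->
  reads k y k.
Proof.
move=> u_inj ki kj kP yk yi yj.
have [|t tP] := g_reads (x := k) (y := y); first by rewrite eq_sym.
apply: (reads_ends _ tP).
(* The set [{k, y}] misses [i] and [j], so [t] must be [k] or [y]. *)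
have := @reads_separate _ _ _ _ _ _ [set k; y] u_inj kP tP.
rewrite !inE !eqxx orbT !(eq_sym i) !(eq_sym j) (negPf ki) (negPf kj).
by rewrite (negPf yi) (negPf yj) => /(_ erefl erefl)/esym/orP[]/eqP->; auto.
Qed.

Lemma reads_partner (i j k : 'I_n) :
    injective u -> i != j -> k != i -> k != j -> reads i j k -> reads k i k.
Proof.
move=> u_inj ij ki kj kP; have [t tP] := g_reads ki.
apply: (reads_ends _ tP).
have := @reads_separate _ _ _ _ _ _ [set k; i; j] u_inj kP tP.
rewrite !inE !eqxx !orbT => /(_ erefl erefl)/esym/orP[/orP[]|]/eqP tE; auto.
(* What remains is [t = j]. A fourth index [l] excludes it: [{k, l}] reads [k], and [{j}] meets
   neither [{k, l}] nor [{k, i}]. *)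
have [l] := @ord_fresh [:: i; j; k] n_ge4.
rewrite !inE !negb_or => /and3P[li lj lk].
have lP := reads_fresh u_inj ki kj kP lk li lj.
have := @reads_separate _ _ _ _ _ _ [set j] u_inj lP tP.
by rewrite tE !inE eqxx (negPf kj) (negPf lj) (negPf ij) => /(_ erefl erefl).
Qed.

Lemma reads_sym x y t : reads x y t -> reads y x t.
Proof. by move=> rt b /esym; exact: rt. Qed.

Lemma reads_common :
    injective u -> exists k, forall x y, x != y -> reads x y k.
Proof.
move=> u_inj; have [|i _] := @ord_fresh [::]; first exact: leq_trans n_ge4.
have [|j] := @ord_fresh [:: i]; first exact: leq_trans n_ge4.
rewrite inE => /(reads_outside u_inj)[{}i [{}j [k [ij ki kj kP]]]].
have kyP y : k != y -> reads k y k.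
  have [-> _|yi] := eqVneq y i; first exact: reads_partner kP.
  have [-> _|yj] := eqVneq y j.
    by apply: reads_partner (reads_sym kP) => //; rewrite eq_sym.
  by rewrite eq_sym => yk; exact: reads_fresh kP yk yi yj.
exists k => x y xy.
have [xk|xk] := eqVneq x k; first by rewrite xk; apply: kyP; rewrite -xk.
have [yk|yk] := eqVneq y k.
  by rewrite yk; apply/reads_sym/kyP; rewrite -yk eq_sym.
have [t tP] := g_reads xy.
(* For a pair avoiding [k], the singleton [{k}] forces [t = k]. *)
have := @reads_separate _ _ _ _ _ _ [set k] u_inj kP tP.
rewrite !inE eqxx !(eq_sym _ k) (negPf ki) (negPf kj) !(eq_sym k).
rewrite (negPf xk) (negPf yk).
by move=> /(_ erefl erefl)/esym/eqP <-.
Qed.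

(** On two letters a non-injective [u] is constant, so the index could matter only on constant
    tuples, where all entries agree. *)
Lemma const_or_entry_noninj (k l : 'I_n) (b : n.-tuple A) :
    ~ injective u ->
  const_or_entry con u k b = const_or_entry con u l b.
Proof.
move=> u_ninj; rewrite /const_or_entry.
have [x [y [xy uxy]]] : exists x y, x != y /\ u x = u y.
  apply: contra_notP u_ninj => h x y uxy.
  by apply/eqP/negP => /negP xy; apply: h; exists x, y.
have uE z : u z = u x.
  have : z \in [set x; y].
    suff -> : [set x; y] = [set: A]%SET by [].
    by apply/eqP; rewrite eqEcard finset.subsetT cardsT card_A cards2 xy.
  by rewrite !inE => /orP[]/eqP->.
rewrite !uE; case: forallP => [h|nk].
  by rewrite -(eqP (h l)); case: forallP => // - []i; rewrite (eqP (h i)) (eqP (h l)).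
by case: forallP => // h; case: nk => i; rewrite (eqP (h i)) (eqP (h k)).
Qed.

Lemma const_or_entry_of_reads : exists k, g =1 const_or_entry con u k.
Proof.
have repeats (b : n.-tuple A) : exists x y, x != y /\ tnth b x = tnth b y.
  have /injectivePn[x [y xy bxy]] : ~~ injectiveb (tnth b).
    apply/negP => /injectiveP/leq_card; rewrite card_ord card_A.
    by apply/negP; rewrite -ltnNge (leq_trans _ n_ge4).
  by exists x, y.
have [/reads_common[k kP]|u_ninj] := pselect (injective u).
  by exists k => b; have [x [y [/kP rk /rk]]] := repeats b.
have [|k _] := @ord_fresh [::]; first exact: leq_trans n_ge4.
exists k => b; have [x [y [/g_reads[t rt] /rt->]]] := repeats b.
exact: const_or_entry_noninj.
Qed.

End CommonEntry.

(** * Decks and reconstruction *)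

Lemma deck_const (A B : Type) (n : nat) (f g : n.+1.-tuple A -> B) :
    (forall I J, fun_class (id_minor f I) = fun_class (id_minor f J)) ->
    deck g = deck f ->
  forall I, fun_class (id_minor g I) = fun_class (id_minor f I).
Proof.
move=> f_same gf I; set C := fun_class (id_minor f I).
have := congr1 (@^~ C) gf; rewrite /deck.
(* In the deck of [f] the class [C] has multiplicity the number of all pairs; equal multiplicity for
   [g] leaves no pair outside [C]. *)
rewrite [X in _ = X](@eq_card _ _ predT) => [gC|J]; last first.
  by rewrite !inE (f_same J I); apply/asboolP.
have /subset_cardP/(_ (subset_predT _))/(_ I) := gC.
by rewrite !inE => /asboolP.
Qed.

Lemma fun_equiv_sym (A B : Type) (n : nat) (f g : n.-tuple A -> B) :
  fun_equiv f g -> fun_equiv g f.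
Proof.
case=> s fE; exists s^-1%g => a; rewrite fE; congr g.
by apply: eq_from_tnth => i; rewrite !tnth_mktuple permK.
Qed.

Lemma fun_equiv_trans (A B : Type) (n : nat) (f g h : n.-tuple A -> B) :
  fun_equiv f g -> fun_equiv g h -> fun_equiv f h.
Proof.
case=> s fE [t gE]; exists (t * s)%g => a; rewrite fE gE; congr h.
by apply: eq_from_tnth => i; rewrite !tnth_mktuple permM.
Qed.

Lemma fun_class_eq (A B : Type) (n : nat) (f g : n.-tuple A -> B) :
  fun_equiv f g -> fun_class f = fun_class g.
Proof.
move=> fg; apply/seteqP; split=> h /=; last exact: fun_equiv_trans.
exact: fun_equiv_trans (fun_equiv_sym fg).
Qed.

Theorem corollary6p3 (A : finType) (B : Type) (n : nat)
    (hB : exists b1 b2 : B, b1 <> b2)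
    (hn : 4 <= n.+1) (hA : #|A| = 2)
    (f : n.+1.-tuple A -> B)
    (hf : weakly_determined_ofo f) :
  reconstructible f.
Proof.
have [con [u [k fE]]] := weakly_determined_const_or_entry hA hf.
have fIE I : id_minor f I =1 const_or_entry con u (delta I k).
  by move=> a; rewrite /id_minor fE const_or_entry_comp //; exact: delta_surj.
move=> g gf.
have gIE I : exists t, id_minor g I =1 const_or_entry con u t.
  have gfI : fun_equiv (id_minor g I) (id_minor f I).
    suff : fun_class (id_minor g I) (id_minor f I) by [].
    rewrite (deck_const _ (esym gf)).
      exact: (fun_equiv_const_or_entry (fIE I) (fIE I)).
    by move=> J L; apply/fun_class_eq/fun_equiv_const_or_entry.
  (* The permutation relating the two minors moves the index that is read, while [con] and [u] stay
     those of [f]. *)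
  have [s gs] := gfI; exists (s (delta I k)) => a.
  by rewrite gs fIE const_or_entry_perm.
have [l gE] := const_or_entry_of_reads hn hA
  (fun x y => @eq_entry_id_minor _ _ con u _ g x y gIE).
exact: fun_equiv_const_or_entry fE gE.
Qed.
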